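(* Assume the map $\theta$ is invertible. Let $y \in (y_{\min}, y_{\max})$ and $\delta > 0$, let $B_\delta$ be the set attached to $y$ and $\delta$ in the context, and put $\psi_t(y) := \int_X g\circ\varphi_t \, dP_{\theta^{-1}(y)}$ for $t\in T$. Let $\delta'>0$ and let $t_1,t_2,\ldots\in T$ be a sequence of times such that the functions $\{g\circ\varphi_{t_i}\}_{i\in\mathbb{N}}$ are uniformly bounded Lipschitz. Then $$\lim_{n\to\infty}\mu^n\big[\{\,|G_{t_i}-\psi_{t_i}(y)|<\delta' \ \ \forall i\in\mathbb{N}\}\,\big|\,\{G\in B_\delta\}\big]=1.$$
   Context: Setting. $(X,d)$ is a complete separable metric space with its Borel $\sigma$-algebra, $\mu$ is a Borel probability measure on $X$, and $\mu^n$ is the $n$-fold product measure on $X^n$. $g: X\to\mathbb{R}$ is measurable, bounded, and continuous $\mu$-almost everywhere (i.e. its set of discontinuity points is $\mu$-null). $y_{\min}=\inf g(X)$, $y_{\max}=\sup g(X)$, $Y=[y_{\min},y_{\max}]$, $y_*=\int_X g\,d\mu$. $T\subseteq\mathbb{R}$ is a set of times with $0\in T$; for each $t\in T$, $\varphi_t:X\to X$ is measurable and continuous $\mu$-a.e., with $\varphi_0=\mathrm{id}$. For $(x_1,\dots,x_n)\in X^n$: $G(x_1,\dots,x_n)=\frac1n\sum_{i=1}^n g(x_i)$ and $G_t(x_1,\dots,x_n)=\frac1n\sum_{i=1}^n g(\varphi_t(x_i))$ (dependence on $n$ suppressed). Canonical measures. For $\lambda\in\mathbb{R}$, $Z(\lambda)=\int_X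 e^{\lambda g}\,d\mu$ and $P_\lambda$ is the probability measure with $dP_\lambda = \frac{e^{\lambda g}}{Z(\lambda)}\,d\mu$. The map $\theta:[-\infty,+\infty]\to Y$ is given by $\theta(\lambda)=\int_X g\,dP_\lambda$ for $\lambda\in\mathbb{R}$, $\theta(-\infty)=y_{\min}$, $\theta(+\infty)=y_{\max}$. Conditioning sets. For $y\in(y_{\min},y_{\max})$ and $\delta>0$: $B_\delta=(y-\delta,y]$ if $y<y_*$; $B_\delta=[y,y+\delta)$ if $y>y_*$; $B_\delta=(y_*-\delta,y_*+\delta)$ if $y=y_*$. Conditional probabilities given $\{G\in B_\delta\}$ are considered for $n$ large enough that the conditioning event has positive probability. Bounded Lipschitz norm. For $f:X\to\mathbb{R}$, $\|f\|_{\mathrm L}=\sup_{x\ne x'}\frac{|f(x)-f(x')|}{d(x,x')}$, $\|f\|_{\mathrm{BL}}=\|f\|_{\mathrm L}+\|f\|_\infty$, where $\|\cdot\|_\infty$ is the supremum norm. A family $\{f_i\}_{i\in\mathbb{N}}$ is uniformly bounded Lipschitz if there is a finite $K$ with $\|f_i\|_{\mathrm{BL}}\le K$ for all $i$. *)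

(* Defs.v *)
From HB Require Import structures.
From mathcomp Require Import all_boot all_order all_algebra.
From mathcomp Require Import all_classical all_reals all_analysis.
From mathcomp Require Import metric_structure measurable_realfun.

Set Implicit Arguments.
Unset Strict Implicit.
Unset Printing Implicit Defensive.

Import Order.TTheory GRing.Theory Num.Theory.
Import numFieldNormedType.Exports.

Local Open Scope classical_set_scope.
Local Open Scope ring_scope.

(* The structure does not relate the sigma-algebra to the topology: see
   [borel_space]. *)
#[short(type="completeMetricMeasurableType")]
HB.structure Definition CompleteMetricMeasurable (R : numDomainType)
    (d : measure_display) :=
  {X of Complete X & Metric R X & Measurable d X}.

Definition separable (X : topologicalType) : Prop :=
  exists2 D : set X, countable D & dense D.

Definition borel_space (R : realType) (d : measure_display)
    (X : completeMetricMeasurableType R d) : Prop :=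
  d.-measurable = <<s @open X >>.

Section product_probability.
Context {d : measure_display} {T : measurableType d} {R : realType}.

Definition tuple_cons n (x : T * n.-tuple T) : n.+1.-tuple T :=
  [the n.+1.-tuple T of x.1 :: x.2].

Lemma measurable_tuple_cons n : measurable_fun setT (@tuple_cons n).
Proof. exact: measurable_cons. Qed.

HB.instance Definition _ n :=
  isMeasurableFun.Build _ _ _ _ (@tuple_cons n) (@measurable_tuple_cons n).

Fixpoint product_probability (mu : probability T R) (n : nat) :
    probability (n.-tuple T) R :=
  match n with
  | 0%N => \d_([tuple] : 0.-tuple T)
  | m.+1 => distribution (mu \x product_probability mu m)%E (@tuple_cons m)
  end.

Lemma product_probabilityE (mu : probability T R) n (A : 'I_n -> set T) :
  (forall i, measurable (A i)) ->
  product_probability mu n [set x | forall i, A i (tnth x i)] =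
  (\prod_(i < n) mu (A i))%E.
Proof.
elim: n A => [|n IHn] A mA.
  by rewrite big_ord0 /= diracE mem_set// => -[].
pose B := [set x : n.-tuple T | forall i, A (lift ord0 i) (tnth x i)].
have mB : measurable B.
  rewrite (_ : B = \bigcap_(i in [set: 'I_n])
      (@tnth _ T ^~ i) @^-1` A (lift ord0 i)); last first.
    by apply/seteqP; split => x Bx i => [_|]; exact: Bx.
  apply: fin_bigcap_measurable => // i _.
  by rewrite -[X in measurable X]setTI; exact: measurable_tnth.
rewrite big_ord_recl -IHn//= -product_measure1E// /distribution /pushforward.
congr (_ _); apply/seteqP; split => [[x t] /= h|[x t] /= [h1 h2] i].
  split=> [|i]; first exact: (h ord0).
  by have := h (lift ord0 i); rewrite tnthS.
by case: (unliftP ord0 i) => [j|] ->; rewrite ?tnthS//; exact: h2.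
Qed.

End product_probability.

(* Equal to 0 when [B] is null (division by zero). *)
Definition cond_prob {d : measure_display} {T : measurableType d}
    {R : realType} (P : probability T R) (A B : set T) : R :=
  fine (P (A `&` B)) / fine (P B).

Section canonical_measure.
Context {d : measure_display} {X : measurableType d} {R : realType}.
Variables (mu : probability X R) (g : {mfun X >-> R}).

Definition partition_function (l : R) : R := \int[mu]_x expR (l * g x).

Definition canonical_measure (l : R) : set X -> \bar R := fun A =>
  (\int[mu]_(x in A) (expR (l * g x) / partition_function l)%:E)%E.

Variable l : R.

Let density_ge0 x : 0 <= expR (l * g x) / partition_function l.
Proof.
by rewrite divr_ge0 ?expR_ge0// Rintegral_ge0// => *; exact: expR_ge0.
Qed.

Let canonical_measure0 : canonical_measure l set0 = 0%E.
Proof. exact: integral_set0. Qed.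

Let canonical_measure_ge0 A : (0 <= canonical_measure l A)%E.
Proof. by apply: integral_ge0 => x _; rewrite lee_fin. Qed.

Let canonical_measure_sigma_additive :
  semi_sigma_additive (canonical_measure l).
Proof.
move=> F mF tF mUF; rewrite /canonical_measure; apply: cvg_toP.
  apply: ereal_nondecreasing_is_cvgn => m n mn.
  apply: lee_sum_nneg_natr => // k _ _; apply: integral_ge0 => /= x _.
  by rewrite lee_fin.
rewrite ge0_integral_bigcup//=; last by move=> x _; rewrite lee_fin.
apply: (@measurable_funS _ _ _ _ setT) => //; apply/measurable_EFinP; apply: measurable_funM => //.
by apply: measurableT_comp => //; exact: measurable_funM.
Qed.

HB.instance Definition _ := isMeasure.Build _ _ _ (canonical_measure l)
  canonical_measure0 canonical_measure_ge0 canonical_measure_sigma_additive.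

End canonical_measure.

Section theta.
Context {d : measure_display} {X : measurableType d} {R : realType}.

Definition ymin (g : X -> R) : R := inf (range g).
Definition ymax (g : X -> R) : R := sup (range g).

Definition ystar (mu : probability X R) (g : X -> R) : R := \int[mu]_x g x.

Definition theta (mu : probability X R) (g : {mfun X >-> R}) (l : \bar R) : R :=
  match l with
  | r%:E => \int[canonical_measure mu g r]_x g x
  | -oo%E => ymin g
  | +oo%E => ymax g
  end.

Definition theta_invertible (mu : probability X R) (g : {mfun X >-> R}) : Prop :=
  set_bij [set: \bar R] `[ymin g, ymax g] (theta mu g).

Definition theta_inv (mu : probability X R) (g : {mfun X >-> R}) : R -> \bar R :=
  pinv [set: \bar R] (theta mu g).

(* For y strictly between ymin and ymax, theta^-1(y) is a real number and
   [fine] is the identity on it. *)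
Definition psi (mu : probability X R) (g : {mfun X >-> R}) (phi : R -> X -> X)
    (t y : R) : R :=
  \int[canonical_measure mu g (fine (theta_inv mu g y))]_x g (phi t x).

Definition cond_interval (mu : probability X R) (g : X -> R) (y delta : R) :
    set R :=
  if y < ystar mu g then `]y - delta, y]%classic
  else if ystar mu g < y then `[y, y + delta[%classic
  else `]ystar mu g - delta, ystar mu g + delta[%classic.

Definition sample_mean (f : X -> R) (n : nat) (x : n.-tuple X) : R :=
  n%:R^-1 * \sum_(i < n) f (tnth x i).

End theta.

Section bounded_lipschitz.
Context {R : realType} {X : metricType R}.
Local Open Scope ereal_scope.

(* The maximum with 0 only matters on a one-point space, where the supremum
   ranges over the empty set. *)
Definition lip_norm (f : X -> R) : \bar R :=
  maxe 0 (ereal_sup [set (`|f z.1 - f z.2| / mdist z.1 z.2)%:E |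
                     z in [set z : X * X | z.1 != z.2]]).

Definition sup_norm (f : X -> R) : \bar R :=
  ereal_sup [set `|f x|%:E | x in [set: X]].

Definition bl_norm (f : X -> R) : \bar R := lip_norm f + sup_norm f.

Definition uniformly_bounded_lipschitz (f : nat -> X -> R) : Prop :=
  exists K : R, forall i, bl_norm (f i) <= K%:E.

End bounded_lipschitz.

(* Main.v *)
(** With [l = theta^-1(y)], the density of [P_l^n] with respect to [mu^n] is
    [(e^(l G) / Z(l))^n], and [l (G - y) >= 0] on [G \in B_delta]; hence
    [D^n mu^n(E /\ G \in B_delta) <= P_l^n(E)] where [D = e^(l y) / Z(l)].
    Conversely, choosing [l'] close to [l] such that [theta(l')] lies inside
    [B_delta], the law of large numbers under [P_l'] gives
    [mu^n(G \in B_delta) >= 1/2 (D e^kappa)^-n] for large [n], with [kappa] as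
    small as we please.  So it suffices that the event [E] that some [G_{t_i}] is
    [delta']-far from its [P_l]-mean has exponentially small [P_l^n]-probability.
    Since the functions are uniformly bounded Lipschitz and [X] is separable, [E]
    is controlled by the empirical frequencies of finitely many sets, to which
    the Chernoff bound applies. *)

From HB Require Import structures.
Require Import Defs.
From mathcomp Require Import all_boot all_order all_algebra.
From mathcomp Require Import all_classical all_reals all_analysis.
From mathcomp Require Import metric_structure measurable_realfun lra ring.

Import Order.TTheory GRing.Theory Num.Theory.
Import numFieldNormedType.Exports.

Local Open Scope classical_set_scope.
Local Open Scope ring_scope.

(** * Densities and product measures *)

Section density.
Context {d : measure_display} {T : measurableType d} {R : realType}.
Local Open Scope ereal_scope.
Import HBNNSimple.

Definition has_density (mu nu : {measure set T -> \bar R}) (w : T -> R) : Prop :=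
  forall A, measurable A -> nu A = \int[mu]_(x in A) (w x)%:E.

(** [has_density] gives the identity on indicators and linearity on simple functions; monotone
    convergence along [nnsfun_approx] then passes to the limit on both sides. *)
Lemma ge0_integral_density (mu nu : {measure set T -> \bar R}) (w : T -> R)
    (f : T -> \bar R) :
  measurable_fun setT w -> (forall x, (0 <= w x)%R) -> has_density mu nu w ->
  measurable_fun setT f -> (forall x, 0 <= f x) ->
  \int[nu]_x f x = \int[mu]_x (f x * (w x)%:E).
Proof.
move=> mw w0 nuE mf f0.
pose h := nnsfun_approx measurableT mf.
have mhw n : measurable_fun setT (fun x => (h n x)%:E * (w x)%:E).
  by apply: emeasurable_funM; exact/measurable_EFinP.
have hE n : \int[nu]_x (h n x)%:E = \int[mu]_x ((h n x)%:E * (w x)%:E).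
  transitivity (\sum_(r \in range (h n)) \int[nu]_x
      (r * \1_(h n @^-1` [set r]) x)%:E).
    rewrite -ge0_integral_fsum//.
    - by apply: eq_integral => x _; rewrite fimfunE -fsumEFin.
    - by move=> r; apply/measurable_EFinP; exact: measurable_funM.
    - by move=> r x _; exact: nnfun_muleindic_ge0.
  transitivity (\sum_(r \in range (h n)) \int[mu]_x
      ((r * \1_(h n @^-1` [set r]) x)%:E * (w x)%:E)).
    apply: eq_fsbigr => r /[!inE] -[z _ <-].
    under [RHS]eq_integral do rewrite EFinM -muleA.
    under [LHS]eq_integral do rewrite EFinM.
    have mindic : measurable_fun setT
        (fun x => (\1_(h n @^-1` [set h n z]) x)%:E : \bar R).
      exact/measurable_EFinP.
    rewrite !ge0_integralZl ?lee_fin//; last 2 first.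
    - by apply: emeasurable_funM => //; exact/measurable_EFinP.
    - by move=> x _; rewrite mule_ge0// lee_fin.
    congr (_ * _); rewrite integral_indic// setIT nuE// integral_mkcond.
    apply: eq_integral => x _; rewrite patchE indicE.
    by case: ifPn; rewrite (mul1e, mul0e).
  rewrite -ge0_integral_fsum//.
  - apply: eq_integral => x _; rewrite fimfunE -fsumEFin//.
    by rewrite ge0_mule_fsuml// => r; exact: nnfun_muleindic_ge0.
  - move=> r; apply: emeasurable_funM; apply/measurable_EFinP => //.
    exact: measurable_funM.
  - move=> r x _; rewrite mule_ge0 ?lee_fin//.
    by rewrite -lee_fin; exact: nnfun_muleindic_ge0.
have cvgh x : EFin \o h ^~ x @ \oo --> f x by exact: cvg_nnsfun_approx.
transitivity (lim (\int[nu]_x (h n x)%:E @[n --> \oo])).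
  rewrite -monotone_convergence//.
  - by apply: eq_integral => x _; apply/esym/cvg_lim => //; exact: cvgh.
  - by move=> n; exact/measurable_EFinP.
  - by move=> n x _; rewrite lee_fin.
  - by move=> x _ a b ab; rewrite lee_fin; exact/lefP/nd_nnsfun_approx.
under eq_fun do rewrite hE.
rewrite -monotone_convergence//.
- apply: eq_integral => x _; apply/cvg_lim => //.
  by apply: cvgeZr => //; exact: cvgh.
- by move=> n x _; rewrite mule_ge0// lee_fin.
- move=> x _ a b ab; rewrite lee_wpmul2r ?lee_fin//.
  exact/lefP/nd_nnsfun_approx.
Qed.

End density.

Section product_probability_integral.
Context {d : measure_display} {T : measurableType d} {R : realType}.
Local Open Scope ereal_scope.

(** The measure at [n.+1] is a pushforward under [tuple_cons] of a binary product, so Tonelli's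
    theorem separates the first coordinate. All inductions on the number of factors go through this
    identity. *)
Lemma ge0_integral_product_probabilityS (mu : probability T R) n
    (f : n.+1.-tuple T -> \bar R) :
  measurable_fun setT f -> (forall x, 0 <= f x) ->
  \int[product_probability mu n.+1]_x f x =
  \int[mu]_x \int[product_probability mu n]_t f (tuple_cons (x, t)).
Proof.
move=> mf f0 /=; rewrite ge0_integral_distribution//.
rewrite fubini_tonelli1//=.
by apply: measurableT_comp => //; exact: measurable_tuple_cons.
Qed.

Lemma measurable_prod_tnth n (w : T -> R) : measurable_fun setT w ->
  measurable_fun setT (fun x : n.-tuple T => \prod_(i < n) w (tnth x i))%R.
Proof.
move=> mw; apply: measurable_prod => i _.
by apply: measurableT_comp => //; exact: measurable_tnth.
Qed.

Lemma prod_tuple_cons n (w : T -> R) (x : T) (t : n.-tuple T) :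
  (\prod_(i < n.+1) w (tnth (tuple_cons (x, t)) i) =
   w x * \prod_(i < n) w (tnth t i))%R.
Proof.
rewrite big_ord_recl; congr (_ * _)%R.
by apply: eq_bigr => i _; rewrite /tuple_cons tnthS.
Qed.

(** Independence of the coordinates, one factor at a time. With an exponential [w] it factorises the
    moment generating function of a sum. *)
Lemma integral_prod_tnth (mu : probability T R) n (w : T -> R) (a : R) :
  measurable_fun setT w -> (forall x, (0 <= w x)%R) ->
  \int[mu]_x (w x)%:E = a%:E ->
  \int[product_probability mu n]_x (\prod_(i < n) w (tnth x i))%:E = (a ^+ n)%:E.
Proof.
move=> mw w0 wa; have a0 : (0 <= a)%R.
  by rewrite -lee_fin -wa; apply: integral_ge0 => x _; rewrite lee_fin.
elim: n => [|n IHn].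
  by under eq_integral do rewrite big_ord0; rewrite integral_cst//= diracT mule1.
rewrite ge0_integral_product_probabilityS; last 2 first.
- by apply/measurable_EFinP; exact: measurable_prod_tnth.
- by move=> x; rewrite lee_fin prodr_ge0.
under eq_integral => x _.
  under eq_integral do rewrite prod_tuple_cons EFinM.
  rewrite ge0_integralZl//=; last 3 first.
  - apply/measurable_EFinP; exact: measurable_prod_tnth.
  - by move=> t _; rewrite lee_fin prodr_ge0.
  - by rewrite lee_fin.
  rewrite IHn; over.
rewrite ge0_integralZr ?lee_fin ?exprn_ge0//=.
- by rewrite wa -EFinM exprS.
- exact/measurable_EFinP.
- by move=> x _; rewrite lee_fin.
Qed.

(** Induction on the first coordinate: [ge0_integral_density] changes the outer measure, the
    induction hypothesis the inner one, and [w x] moves inside the inner integral. The outer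
    integrand is itself an integral, hence the formulation for functions rather than sets. *)
Lemma ge0_integral_product_density (mu nu : probability T R) (w : T -> R) n
    (f : n.-tuple T -> \bar R) :
  measurable_fun setT w -> (forall x, (0 <= w x)%R) -> has_density mu nu w ->
  measurable_fun setT f -> (forall x, 0 <= f x) ->
  \int[product_probability nu n]_x f x =
  \int[product_probability mu n]_x (f x * (\prod_(i < n) w (tnth x i))%:E).
Proof.
move=> mw w0 nuE; elim: n f => [|n IHn] f mf f0.
  by under [RHS]eq_integral do rewrite big_ord0 mule1.
have mfx x : measurable_fun setT (fun t : n.-tuple T => f (tuple_cons (x, t))).
  apply: measurableT_comp => //; apply: measurableT_comp.
    exact: measurable_tuple_cons.
  exact: pair1_measurable.
rewrite !ge0_integral_product_probabilityS//; last 2 first.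
- apply: emeasurable_funM => //; apply/measurable_EFinP.
  exact: measurable_prod_tnth.
- by move=> x; rewrite mule_ge0// lee_fin prodr_ge0.
rewrite (@ge0_integral_density _ _ _ mu nu w)//.
- apply: eq_integral => x _; rewrite IHn// -ge0_integralZr ?lee_fin//.
  + apply: eq_integral => t _.
    by rewrite prod_tuple_cons EFinM -muleA (muleC (w x)%:E).
  + apply: emeasurable_funM => //; apply/measurable_EFinP.
    exact: measurable_prod_tnth.
  + by move=> t _; rewrite mule_ge0// lee_fin prodr_ge0.
- apply: (@measurable_fun_fubini_tonelli_F _ _ _ _ _ (product_probability nu n)
    (fun z => f (tuple_cons z))) => //.
  by apply: measurableT_comp => //; exact: measurable_tuple_cons.
- by move=> x; exact: integral_ge0.
Qed.

Lemma product_density (mu nu : probability T R) (w : T -> R) n :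
  measurable_fun setT w -> (forall x, (0 <= w x)%R) -> has_density mu nu w ->
  has_density (product_probability mu n) (product_probability nu n)
    (fun x => \prod_(i < n) w (tnth x i))%R.
Proof.
move=> mw w0 nuE A mA.
rewrite -[LHS]mul1e -integral_cst// [LHS]integral_mkcond.
rewrite (@ge0_integral_product_density mu nu w)//; last 2 first.
- apply/(measurable_restrictT _ _).1 => //.
- by move=> x; rewrite patchE; case: ifP.
rewrite [RHS]integral_mkcond; apply: eq_integral => x _; rewrite !patchE.
by case: ifP => _; rewrite (mul1e, mul0e).
Qed.

End product_probability_integral.

(** * Exponential bounds *)

Section exp_decay.
Context {R : realType}.

(** The factor [C] absorbs finite union bounds and small values of [n]; the geometric ratio
    [expR (- c)] lies strictly below 1. *)
Definition exp_decay (u : nat -> \bar R) : Prop :=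
  exists C c : R, [/\ 0 <= C, 0 < c &
    forall n, (u n <= (C * expR (- c) ^+ n)%:E)%E].

Lemma le_exp_decay (u v : nat -> \bar R) :
  (forall n, (u n <= v n)%E) -> exp_decay v -> exp_decay u.
Proof.
move=> uv [C [c [C0 c0 vE]]]; exists C, c; split=> // n.
exact: le_trans (uv n) (vE n).
Qed.

Lemma exp_decay0 : exp_decay (fun=> 0%E).
Proof. by exists 0, 1; split=> // n; rewrite mul0r. Qed.

Lemma exp_decayD (u v : nat -> \bar R) :
  exp_decay u -> exp_decay v -> exp_decay (fun n => u n + v n)%E.
Proof.
move=> [C [c [C0 c0 uE]]] [D [e [D0 e0 vE]]].
exists (C + D), (Num.min c e); split; [lra|by rewrite lt_min c0|move=> n].
rewrite mulrDl EFinD; apply: leeD.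
- apply: (le_trans (uE n)); rewrite lee_fin ler_wpM2l//.
  by rewrite lerXn2r ?nnegrE ?expR_ge0// ler_expR lerN2 ge_min lexx.
- apply: (le_trans (vE n)); rewrite lee_fin ler_wpM2l//.
  by rewrite lerXn2r ?nnegrE ?expR_ge0// ler_expR lerN2 ge_min lexx orbT.
Qed.

(** From [1 - u <= expR (- u)] one gets [expR u <= (1 - u)^-1], and the product of [1 - u] with
    [1 + u + 2 * u ^+ 2] is [1 + u ^+ 2 * (1 - 2 * u)], which is at least 1. *)
Lemma expR_le_quadratic (u : R) : u <= 2^-1 -> expR u <= 1 + u + 2 * u ^+ 2.
Proof.
move=> u2; have u1 : 0 < 1 - u by lra.
have : expR u <= (1 - u)^-1.
  rewrite -[u in expR u]opprK expRN lef_pV2 ?posrE ?expR_gt0//.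
  exact: expR_ge1Dx.
move=> /le_trans; apply; rewrite -[leLHS]mul1r ler_pdivrMr//.
nra.
Qed.

End exp_decay.

(** * Chernoff bounds for sample means *)

Section chernoff.
Context {d : measure_display} {T : measurableType d} {R : realType}.

Lemma probability_nonempty (P : probability T R) : [set: T] !=set0.
Proof.
apply/set0P/eqP => T0; have := @probability_setT _ _ _ P.
by rewrite T0 measure0 => /eqP; rewrite eq_sym onee_eq0.
Qed.

Lemma Rintegral_cst_probability (P : probability T R) (r : R) :
  \int[P]_x r = r.
Proof.
by rewrite /Rintegral integral_cst// [X in (_ * X)%E]probability_setT mule1.
Qed.

Lemma bounded_integrable (P : probability T R) (f : T -> R) (M : R) :
  measurable_fun setT f -> (forall x, `|f x| <= M) ->
  P.-integrable setT (EFin \o f).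
Proof.
move=> mf fM; apply: measurable_bounded_integrable => //.
  by rewrite -ge0_fin_numE ?fin_num_measure.
exists M; split; first exact: num_real.
by move=> N MN x _; exact: le_trans (fM x) (ltW MN).
Qed.

Lemma measurable_sample_mean n (f : T -> R) : measurable_fun setT f ->
  measurable_fun setT (fun x : n.-tuple T => sample_mean f x).
Proof.
move=> mf; apply: measurable_funM => //; apply: measurable_sum => i.
by apply: measurableT_comp => //; exact: measurable_tnth.
Qed.

(** The shifted variable [W] has mean [- e]; integrating the quadratic bound on [expR (s * W)]
    leaves at most [1 - s * e / 2], which is below [expR (- (s * e / 2))]. *)
Lemma exponential_moment_lt1 (P : probability T R) (h : T -> R) (M e : R) :
  measurable_fun setT h -> (forall x, `|h x| <= M) -> 0 < e ->
  exists s c : R, [/\ 0 <= s, 0 < c &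
    (\int[P]_x (expR (s * (h x - (\int[P]_x h x + e))))%:E <= (expR (- c))%:E)%E].
Proof.
move=> mh hM e0; set m := \int[P]_x h x.
have [x0 _] := probability_nonempty P.
pose W x := h x - (m + e).
pose B := M + `|m| + e.
have mW : measurable_fun setT W by exact: measurable_funB.
have M0 : 0 <= M := le_trans (normr_ge0 _) (hM x0).
have WB x : `|W x| <= B.
  rewrite /W /B (le_trans (ler_normB _ _))// -addrA lerD//.
  by rewrite (le_trans (ler_normD _ _))// (gtr0_norm e0).
have ih : P.-integrable setT (EFin \o h) by exact: bounded_integrable mh hM.
have icst (r : R) : P.-integrable setT (EFin \o cst r).
  exact: (@bounded_integrable P (cst r) `|r|).
have intW : \int[P]_x W x = - e.
  rewrite /W (RintegralB _ ih (icst (m + e)))//.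
  by rewrite /= Rintegral_cst_probability -/m; lra.
have B0 : 0 < B by rewrite /B; have := normr_ge0 m; lra.
have eB : e <= B by rewrite /B; have := normr_ge0 m; lra.
(* This value minimises [- s * e + 2 * s ^+ 2 * B ^+ 2], and [e <= B] keeps [s * B] at most 1/4,
   within the range of [expR_le_quadratic]. *)
pose s := e / (4 * B ^+ 2).
have B2 : 0 < B ^+ 2 by rewrite exprn_gt0.
have s0 : 0 <= s by rewrite divr_ge0//; lra.
have sB : s * B <= 2^-1.
  rewrite /s (_ : e / (4 * B ^+ 2) * B = e / B / 4); last by field; rewrite gt_eqF.
  have : e / B <= 1 by rewrite ler_pdivrMr// mul1r.
  lra.
have sB2 : 2 * s ^+ 2 * B ^+ 2 = s * e / 2.
  by rewrite /s; field; rewrite gt_eqF.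
have spos : 0 < s by rewrite divr_gt0//; lra.
exists s, (s * e / 2); split => //; first by apply: divr_gt0 => //; exact: mulr_gt0.
have le1 x : expR (s * W x) <= 1 + s * W x + 2 * s ^+ 2 * B ^+ 2.
  have sW : s * W x <= 2^-1.
    by apply: le_trans sB; rewrite ler_wpM2l// (le_trans (ler_norm _)).
  apply: (le_trans (expR_le_quadratic _ sW)).
  rewrite lerD2l exprMn mulrA; apply: ler_wpM2l.
    by apply: mulr_ge0 => //; exact: sqr_ge0.
  by rewrite -real_normK ?num_real// lerXn2r ?nnegrE ?normr_ge0// ltW.
apply: (@le_trans _ _ (\int[P]_x (s * W x + (1 + s * e / 2))%:E)%E).
  apply: ge0_le_integral => //.
  - by apply/measurable_EFinP; apply: measurableT_comp => //; exact: measurable_funM.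
  - by apply/measurable_EFinP; apply: measurable_funD => //; exact: measurable_funM.
  - by move=> x _; rewrite lee_fin (le_trans (le1 x))// sB2; lra.
have isW : P.-integrable setT (EFin \o (fun x => s * W x)).
  apply: (@bounded_integrable P _ (s * B)); first exact: measurable_funM.
  by move=> x; rewrite normrM ger0_norm// ler_wpM2l.
have iW : P.-integrable setT (EFin \o W) by exact: bounded_integrable mW WB.
have iWc : P.-integrable setT (EFin \o (fun x => s * W x + (1 + s * e / 2))).
  rewrite (_ : EFin \o _ =
    (EFin \o (fun x => s * W x)) \+ (EFin \o cst (1 + s * e / 2)))//.
  exact: integrableD.
rewrite -[leLHS]fineK; last exact: integrable_fin_num.
have -> : fine (\int[P]_x (s * W x + (1 + s * e / 2))%:E)%E =
    s * \int[P]_x W x + \int[P]_x (1 + s * e / 2).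
  by rewrite -RintegralZl// -(RintegralD _ isW (icst (1 + s * e / 2))).
rewrite intW Rintegral_cst_probability lee_fin.
apply: le_trans (expR_ge1Dx _); lra.
Qed.

(** Chernoff's argument: on the tail event the product of the [expR (s * (h x_i - (m + e)))] is at
    least 1, and its integral factorises into the n-th power of a number at most [expR (- c)]. *)
Lemma sample_mean_upper_tail (P : probability T R) (h : T -> R) (M e : R) :
  measurable_fun setT h -> (forall x, `|h x| <= M) -> 0 < e ->
  exp_decay (fun n => product_probability P n
    [set x | \int[P]_x h x + e <= sample_mean h x]).
Proof.
move=> mh hM e0.
have [s [c [s0 c0 le_c]]] := exponential_moment_lt1 P _ _ _ mh hM e0.
exists 1, c; split => // n; rewrite mul1r.
set m := \int[P]_x h x in le_c *.
have mS : measurable [set x : n.-tuple T | m + e <= sample_mean h x].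
  rewrite -[X in measurable X]setTI.
  by apply: measurable_fun_le => //; exact: measurable_sample_mean.
(* The empty sample has mean 0 by division by zero; there the bound is 1 and holds for any
   probability. *)
case: n => [|n] in mS *; first by rewrite expr0 probability_le1.
pose w x := expR (s * (h x - (m + e))).
have mw : measurable_fun setT w.
  apply: measurableT_comp => //; apply: measurable_funM => //.
  exact: measurable_funB.
have w0 x : 0 <= w x by exact: expR_ge0.
pose a := fine (\int[P]_x (w x)%:E)%E.
have fa : (\int[P]_x (w x)%:E)%E = a%:E.
  rewrite fineK// ge0_fin_numE; last by apply: integral_ge0 => x _; rewrite lee_fin.
  exact: le_lt_trans le_c (ltry _).
have a0 : 0 <= a by rewrite fine_ge0//; apply: integral_ge0 => x _; rewrite lee_fin.
have ac : a <= expR (- c) by rewrite -lee_fin -fa.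
apply: (@le_trans _ _ (a ^+ n.+1)%:E); last first.
  by rewrite lee_fin lerXn2r ?nnegrE ?expR_ge0.
rewrite -(@integral_prod_tnth _ _ _ P n.+1 w a)// -[leLHS]mul1e -integral_cst//.
rewrite integral_mkcond; apply: ge0_le_integral => //.
- by move=> x _; rewrite patchE; case: ifP.
- by apply/(measurable_restrictT _ _).1.
- by apply/measurable_EFinP; exact: measurable_prod_tnth.
move=> x _; rewrite patchE; case: ifPn => [/[!inE]/= xS|_]; last first.
  by rewrite lee_fin prodr_ge0.
rewrite lee_fin /w -expR_sum -[leLHS]expR0 ler_expR -mulr_sumr mulr_ge0//.
rewrite sumrB sumr_const card_ord subr_ge0 -mulr_natl.
by move: xS; rewrite /sample_mean mulrC ler_pdivlMr ?ltr0n// mulrC.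
Qed.

End chernoff.

Section deviation.
Context {d : measure_display} {T : measurableType d} {R : realType}.

Lemma measurable_sample_mean_preimage n (f : T -> R) (A : set R) :
  measurable_fun setT f -> measurable A ->
  measurable [set x : n.-tuple T | A (sample_mean f x)].
Proof.
by move=> mf mA; rewrite -[X in measurable X]setTI; exact: measurable_sample_mean.
Qed.

(** A countable intersection of preimages of balls; countability of the family of times enters
    here. *)
Lemma measurable_uniform_deviation n (F : nat -> T -> R) (m : nat -> R) (e : R) :
  (forall i, measurable_fun setT (F i)) ->
  measurable [set x : n.-tuple T | forall i, `|sample_mean (F i) x - m i| < e].
Proof.
move=> mF; rewrite (_ : mkset _ = \bigcap_i [set x : n.-tuple T |
    ball (m i) e (sample_mean (F i) x)]); last first.
  apply/seteqP; split=> x /= h i; have := h i;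
  by rewrite /ball/= distrC => // /(_ I).
apply: bigcapT_measurable => i; apply: measurable_sample_mean_preimage => //.
exact: measurable_ball.
Qed.

(** The event is covered by the upper tails of [h] and of [- h]. *)
Lemma sample_mean_deviation (P : probability T R) (h : T -> R) (M e : R) :
  measurable_fun setT h -> (forall x, `|h x| <= M) -> 0 < e ->
  exp_decay (fun n => product_probability P n
    [set x | e <= `|sample_mean h x - \int[P]_x h x|]).
Proof.
move=> mh hM e0.
have hNM x : `|- h x| <= M by rewrite normrN.
have mNh : measurable_fun setT (fun x => - h x) by exact: measurableT_comp.
have := exp_decayD _ _ (sample_mean_upper_tail P _ _ _ mh hM e0)
  (sample_mean_upper_tail P _ _ _ mNh hNM e0).
apply: le_exp_decay => n.
have EN : \int[P]_x (- h x) = - \int[P]_x h x.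
  under eq_Rintegral do rewrite -mulN1r.
  by rewrite RintegralZl ?mulN1r//; exact: bounded_integrable mh hM.
have mtail (f : T -> R) (mf : measurable_fun setT f) : measurable
    [set x : n.-tuple T | \int[P]_x f x + e <= sample_mean f x].
  rewrite -[X in measurable X]setTI.
  by apply: measurable_fun_le => //; exact: measurable_sample_mean.
apply: le_trans (measureU2 _ _ _); [|exact: mtail|exact: mtail].
apply: le_measure; rewrite ?inE.
- rewrite -[X in measurable X]setTI.
  apply: measurable_fun_le => //; apply: measurableT_comp => //.
  by apply: measurable_funB => //; exact: measurable_sample_mean.
- by apply: measurableU; exact: mtail.
move=> x /=; rewrite ler_normr EN => /orP[]; [left; lra|right].
have -> : sample_mean (fun x => - h x) x = - sample_mean h x.
  by rewrite /sample_mean sumrN mulrN.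
lra.
Qed.

End deviation.

(** * Partition of a separable metric space into small cells *)

Section cells.
Context {R : realType} {d : measure_display}.

Lemma interior_ball_cover (X : metricType R) (q x : X) (e : R) :
  mdist q x < e -> (ball q e)° x.
Proof.
move=> qx; rewrite /interior -nbhs_ballE; exists (e - mdist q x).
  by rewrite /= subr_gt0.
move=> z; rewrite !ballEmdist/= => xz.
by rewrite (le_lt_trans (metric_triangle q x z))//; lra.
Qed.

(** Small balls around a countable dense set cover the space. Assigning each point to its first ball
    makes them disjoint, and the points missed by the first [k] balls decrease to the empty set, so
    by continuity from above some finite stage [N] leaves mass below [e]; that remainder is the cell
    [C N]. *)
Lemma small_diameter_partition (X : completeMetricMeasurableType R d)
    (P : probability X R) (e : R) : separable X -> borel_space X -> 0 < e ->
  exists N (C : nat -> set X), [/\ forall k, measurable (C k),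
    forall x, exists2 k, (k <= N)%N &
      C k x /\ forall j, (j <= N)%N -> C j x -> j = k,
    forall k x z, (k < N)%N -> C k x -> C k z -> mdist x z < 2 * e &
    (P (C N) < e%:E)%E].
Proof.
move=> [D /countable_injP[f finj] denseD] borel e0.
(* The injection [f] numbers the dense points: [F k] comes from the one numbered [k], and is empty
   if there is none. Taking interiors makes it open, hence Borel. *)
pose F k : set X := \bigcup_(q in [set q | D q /\ f q = k]) (ball q e)°.
have mopen (U : set X) : open U -> measurable U.
  by move=> oU; rewrite borel; exact: sub_sigma_algebra.
have mF k : measurable (F k).
  by apply: mopen; apply: bigcup_open => q _; exact: open_interior.
have Fcover x : exists k, F k x.
  have [|q [xq Dq]] := denseD (ball x e)° _ (open_interior _).
    by exists x; apply: interior_ball_cover; rewrite mdistxx.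
  exists (f q), q => //; apply: interior_ball_cover.
  by have := interior_subset xq; rewrite ballEmdist/= metric_sym.
pose E k : set X := ~` \bigcup_(j in `I_k) F j.
have mE k : measurable (E k).
  by apply: measurableC; apply: bigcup_measurable.
have E0 : \bigcap_k E k = set0.
  apply/seteqP; split => // x Ex; have [k Fk] := Fcover x.
  by have /= := Ex k.+1 I; apply; exists k => //=.
have cvgE : P \o E @ \oo --> 0%E.
  rewrite -(measure0 P) -E0; apply: nonincreasing_cvg_mu => //.
  - by rewrite -ge0_fin_numE ?fin_num_measure.
  - by rewrite E0.
  - move=> m n mn; apply/subsetPset; apply: subsetC; apply: bigcup_subset.
    by move=> k /=; move/leq_trans; apply.
have [N PEN] : exists N, (P (E N) < e%:E)%E.
  have cvE : fine (P (E n)) @[n --> \oo] --> (0 : R) by exact: fine_cvg cvgE.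
  move/cvgrPdist_lt : cvE => /(_ _ e0)/filter_ex[N]/=.
  rewrite sub0r normrN => PN; exists N.
  rewrite -[P (E N)]fineK ?fin_num_measure// lte_fin.
  exact: le_lt_trans (ler_norm _) PN.
(* [F k] inside [E k] consists of the points whose first ball is [k]. Every index from [N] on gives
   the remainder, so uniqueness of the cell is claimed only among indices up to [N]. *)
pose C k := if (k < N)%N then F k `&` E k else E N.
have Clt k : (k < N)%N -> C k = F k `&` E k by rewrite /C => ->.
have CN : C N = E N by rewrite /C ltnn.
exists N, C; split.
- by move=> k; rewrite /C; case: ifP => // _; exact: measurableI.
- move=> x.
  have Fx : exists k, `[< F k x >].
    by have [k Fk] := Fcover x; exists k; apply/asboolP.
  (* The cell of [x] is the least index [k] with [F k x] if that is below [N], and [N] otherwise. *)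
  have [k /asboolP Fk kmin] := ex_minnP Fx.
  have Ej j : (j <= k)%N -> E j x.
    move=> jk [i /= ij Fi]; have /kmin : `[< F i x >] by exact/asboolP.
    by rewrite leqNgt (leq_trans ij jk).
  have [kN|Nk] := ltnP k N; last first.
    exists N => //; rewrite CN; split; first exact: Ej.
    move=> j; rewrite leq_eqVlt => /predU1P[//|jN].
    rewrite Clt// => -[Fj _]; have /kmin : `[< F j x >] by exact/asboolP.
    by rewrite leqNgt (leq_trans jN Nk).
  exists k; first exact: ltnW.
  rewrite Clt//; split; first by split => //; exact: Ej.
  move=> j jN Cj; have {}Cj : E j x /\ (j < N -> F j x)%N.
    move: jN Cj; rewrite leq_eqVlt => /predU1P[->|jN]; first by rewrite CN ltnn.
    by rewrite Clt// => -[].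
  have jk : (j <= k)%N.
    by rewrite leqNgt; apply/negP => kj; case: Cj => + _; apply; exists k.
  apply/eqP; rewrite eqn_leq jk/= kmin//; apply/asboolP.
  by case: Cj => _; apply; exact: leq_ltn_trans jk kN.
- move=> k x z kN; rewrite Clt// => -[[q [Dq fq] /interior_subset qx] _].
  move=> [[q' [Dq' fq'] /interior_subset qz] _].
  have qq : q' = q by apply: finj; rewrite ?inE// fq fq'.
  move: qx qz; rewrite qq !ballEmdist/= => qx qz.
  rewrite (le_lt_trans (metric_triangle x q z))// (metric_sym x q); lra.
- by rewrite CN.
Qed.

End cells.

(** * Uniform deviations over bounded Lipschitz functions *)

Section step_functions.
Context {d : measure_display} {T : measurableType d} {R : realType}.

Lemma indic_norm_le1 (A : set T) (x : T) : `|\1_A x : R| <= 1.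
Proof. by rewrite indicE ger0_norm ?ler0n// lern1 leq_b1. Qed.

Lemma Rintegral_sum_indic (P : probability T R) (C : nat -> set T)
    (a : nat -> R) N : (forall k, measurable (C k)) ->
  \int[P]_x (\sum_(k < N) a k * \1_(C k) x) =
  \sum_(k < N) a k * \int[P]_x \1_(C k) x.
Proof.
move=> mC.
have iC k : P.-integrable setT (EFin \o (fun x => \1_(C k) x : R)).
  apply: (bounded_integrable P _ 1) => [|x]; first exact: measurable_indic.
  exact: indic_norm_le1.
have iaC k : P.-integrable setT (EFin \o (fun x => a k * \1_(C k) x)).
  apply: (bounded_integrable P _ `|a k|); first exact: measurable_funM.
  by move=> x; rewrite normrM ler_piMr// indic_norm_le1.
have iS n : P.-integrable setT
    (EFin \o (fun x => \sum_(k < n) a k * \1_(C k) x)).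
  apply: (bounded_integrable P _ (\sum_(k < n) `|a k|)).
    by apply: measurable_sum => k; exact: measurable_funM.
  move=> x; apply: (le_trans (ler_norm_sum _ _ _)); apply: ler_sum => k _.
  by rewrite normrM ler_piMr// indic_norm_le1.
elim: N => [|N IHN].
  under eq_Rintegral do rewrite big_ord0.
  by rewrite Rintegral_cst_probability big_ord0.
under eq_Rintegral do rewrite big_ord_recr/=.
by rewrite (RintegralD _ (iS N) (iaC N))// IHN RintegralZl// big_ord_recr.
Qed.

Lemma sample_mean_sum_indic n (x : n.-tuple T) (C : nat -> set T)
    (a : nat -> R) N :
  sample_mean (fun x => \sum_(k < N) a k * \1_(C k) x) x =
  \sum_(k < N) a k * sample_mean \1_(C k) x.
Proof.
rewrite /sample_mean exchange_big mulr_sumr; apply: eq_bigr => k _.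
by rewrite mulrCA -mulr_sumr.
Qed.

Lemma sample_mean_dist n (x : n.-tuple T) (f g h : T -> R) (c K : R) :
  (0 < n)%N -> (forall x, `|f x - g x| <= c + K * h x) ->
  `|sample_mean f x - sample_mean g x| <= c + K * sample_mean h x.
Proof.
move=> n0 fg; have n0' : (n%:R : R) != 0 by rewrite pnatr_eq0 -lt0n.
rewrite /sample_mean -mulrBr -sumrB normrM ger0_norm ?invr_ge0//.
rewrite -[X in X + _](mulKf n0') [n%:R * c]mulr_natl mulrCA -mulrDr.
rewrite ler_wpM2l ?invr_ge0//.
apply: (le_trans (ler_norm_sum _ _ _)).
rewrite mulr_sumr -[X in c *+ X]card_ord -sumr_const -big_split/=.
by apply: ler_sum => i _; exact: fg.
Qed.

Lemma Rintegral_dist (P : probability T R) (f g h : T -> R) (c K M : R) :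
  measurable_fun setT f -> measurable_fun setT g -> measurable_fun setT h ->
  (forall x, `|f x| <= M) -> (forall x, `|g x| <= M) -> (forall x, `|h x| <= M) ->
  (forall x, `|f x - g x| <= c + K * h x) ->
  `|\int[P]_x f x - \int[P]_x g x| <= c + K * \int[P]_x h x.
Proof.
move=> mf mg mh fM gM hM fg.
have if_ := bounded_integrable P _ _ mf fM.
have ig := bounded_integrable P _ _ mg gM.
have ih := bounded_integrable P _ _ mh hM.
have iKh : P.-integrable setT (EFin \o (fun x => K * h x)).
  apply: (bounded_integrable P _ (`|K| * M)); first exact: measurable_funM.
  by move=> x; rewrite normrM ler_wpM2l.
have icst : P.-integrable setT (EFin \o (fun=> c)).
  exact: (bounded_integrable P _ `|c|).
have iB : P.-integrable setT (EFin \o (fun x => f x - g x)).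
  apply: (bounded_integrable P _ (M + M)); first exact: measurable_funB.
  by move=> x; rewrite (le_trans (ler_normB _ _))// lerD.
have iD : P.-integrable setT (EFin \o (fun x => c + K * h x)).
  apply: (bounded_integrable P _ (`|c| + `|K| * M)).
    by apply: measurable_funD => //; exact: measurable_funM.
  move=> x; rewrite (le_trans (ler_normD _ _))// lerD2l normrM.
  by rewrite ler_wpM2l.
rewrite -RintegralB// -RintegralZl// -[X in X + _](Rintegral_cst_probability P).
rewrite -RintegralD//; apply: (le_trans (le_normr_Rintegral _ iB)) => //.
apply: le_Rintegral => //.
apply: (bounded_integrable P _ (M + M)).
  by apply: measurableT_comp => //; exact: measurable_funB.
by move=> x; rewrite normr_id (le_trans (ler_normB _ _))// lerD.
Qed.

End step_functions.

Section uniform_deviation.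
Context {R : realType} {d : measure_display}.

(* Up to a small error, a function of the class is constant on each cell of small
   diameter, and the last cell has small mass; so mean and integral are both
   determined by the frequencies of the cells. *)
Lemma bounded_lipschitz_finite_test (X : completeMetricMeasurableType R d)
    (P : probability X R) (K tol : R) :
  separable X -> borel_space X -> 0 < tol ->
  exists N (C : nat -> set X) (eta : R), [/\ forall k, measurable (C k), 0 < eta &
    forall n (x : n.-tuple X), (0 < n)%N ->
      (forall k, (k <= N)%N ->
         `|sample_mean \1_(C k) x - \int[P]_x \1_(C k) x| < eta) ->
      forall f : X -> R, measurable_fun setT f -> (forall x, `|f x| <= K) ->
        (forall x z, `|f x - f z| <= K * mdist x z) ->
        `|sample_mean f x - \int[P]_x f x| < tol].
Proof.
move=> sepX borelX tol0.
(* Enlarging [K] only widens the class of functions, and a positive [K] may be divided by. *)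
wlog K1 : K / 1 <= K.
  move=> /(_ (Num.max 1 K)); rewrite le_max lexx => /(_ isT).
  move=> [N [C [eta [mC eta0 H]]]].
  exists N, C, eta; split=> // n x n0 xC f mf fK fL.
  apply: H => // [z|z z'].
  - by apply: (le_trans (fK z)); rewrite le_max lexx orbT.
  - by apply: (le_trans (fL z z')); rewrite ler_wpM2r ?mdist_ge0// le_max lexx orbT.
have K0 : 0 < K by lra.
(* Error budget: [K * e] and [K * N.+1 * eta] both equal [tol / 8]. Replacing [f] by a step function
   costs at most [3 * tol / 8] in the integral and [3 * tol / 8 + K * eta] in the mean, and
   comparing the step functions costs [K * N * eta]; the total is [7 * tol / 8]. *)
pose e := tol / (8 * K).
have e0 : 0 < e by rewrite divr_gt0//; lra.
have eE : K * e = tol / 8 by rewrite /e; field; rewrite gt_eqF.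
have [N [C [mC coverC diamC PCN]]] := small_diameter_partition X P e sepX borelX e0.
pose eta := tol / (8 * (N.+1)%:R * K).
have N0 : 0 < (N.+1)%:R :> R by rewrite ltr0n.
have eta0 : 0 < eta by rewrite divr_gt0// !mulr_gt0.
have etaE : K * (N.+1)%:R * eta = tol / 8.
  by rewrite /eta; field; rewrite !gt_eqF.
exists N, C, eta; split=> // n x n0 xC f mf fK fL.
(* [a k] is the value of [f] at some point of the cell, and 0 on an empty cell. *)
have /boolp.choice[a aP] (k : nat) : exists a, `|a| <= K /\
    (forall z, (k < N)%N -> C k z -> `|f z - a| <= 2 * K * e).
  have [[q Cq]|nC] := pselect (exists q, C k q).
    exists (f q); split=> // z kN Cz; apply: (le_trans (fL z q)).
    by rewrite (mulrC 2) -mulrA ler_wpM2l ?(ltW K0)// ltW// (diamC k).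
  by exists 0; split=> [|z _ Cz]; [rewrite normr0 ltW|exfalso; apply: nC; exists z].
(* The sum omits the cell [N], which has no diameter bound; there [s] vanishes and the error is at
   most [K], paid for by the term in [\1_(C N)]. *)
pose s z := \sum_(k < N) a k * \1_(C k) z.
have fs z : `|f z - s z| <= 2 * K * e + K * \1_(C N) z.
  have [k kN [Ck Cuniq]] := coverC z.
  have CE j : (j <= N)%N -> \1_(C j) z = (j == k)%:R :> R.
    move=> jN; rewrite indicE (_ : (z \in C j) = (j == k))//.
    apply/idP/eqP => [/set_mem|->].
      exact: Cuniq.
    exact: mem_set.
  have sE : s z = if (k < N)%N then a k else 0.
    rewrite /s; case: ifPn => kN'.
      rewrite (bigD1 (Ordinal kN'))//= CE// eqxx mulr1 big1 ?addr0// => i ik.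
      rewrite CE ?(ltnW (ltn_ord i))// (_ : _ == _ = false) ?mulr0//.
      exact: negbTE.
    rewrite big1// => i _; rewrite CE ?(ltnW (ltn_ord i))//.
    rewrite (_ : _ == _ = false) ?mulr0//; apply/negbTE.
    by apply: contraNN kN' => /eqP <-.
  rewrite sE CE//; case: ifPn => kN'.
    rewrite (gtn_eqF kN') mulr0 addr0; exact: (aP k).2.
  have -> : k = N by apply/eqP; rewrite eqn_leq kN leqNgt kN'.
  rewrite eqxx mulr1 subr0; apply: (le_trans (fK z)); rewrite lerDr.
  by rewrite -mulrA eE; lra.
have ms : measurable_fun setT s.
  by apply: measurable_sum => k; exact: measurable_funM.
pose M := K + N%:R * K + 1.
have fM z : `|f z| <= M.
  by apply: (le_trans (fK z)); rewrite /M -addrA lerDl addr_ge0// mulr_ge0// ltW.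
have sM z : `|s z| <= M.
  apply: (@le_trans _ _ (N%:R * K)); last by rewrite /M; lra.
  apply: (le_trans (ler_norm_sum _ _ _)).
  rewrite mulr_natl -[X in _ *+ X]card_ord -sumr_const; apply: ler_sum => k _.
  rewrite normrM; apply: le_trans (aP k).1.
  by rewrite ler_piMr// indic_norm_le1.
have CM z : `|\1_(C N) z : R| <= M.
  apply: (le_trans (indic_norm_le1 _ _)); rewrite /M lerDr.
  by rewrite addr_ge0 ?(ltW K0)// mulr_ge0// ltW.
have d1 := sample_mean_dist n x f s \1_(C N) (2 * K * e) K n0 fs.
have d2 := Rintegral_dist P f s \1_(C N) (2 * K * e) K M mf ms
  (measurable_indic (mC N)) fM sM CM fs.
have d3 : `|sample_mean s x - \int[P]_x s x| <= K * N%:R * eta.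
  rewrite sample_mean_sum_indic Rintegral_sum_indic// -sumrB.
  apply: (le_trans (ler_norm_sum _ _ _)).
  rewrite (mulrC K) -mulrA mulr_natl -[X in _ *+ X]card_ord -sumr_const.
  apply: ler_sum => k _; rewrite -mulrBr normrM ler_pM//; first exact: (aP k).1.
  by apply/ltW/xC; exact: ltnW.
have d4 : sample_mean \1_(C N) x - \int[P]_x \1_(C N) x < eta.
  exact: le_lt_trans (ler_norm _) (xC N (leqnn N)).
have d5 : \int[P]_x \1_(C N) x < e.
  rewrite /Rintegral integral_indic// setIT -lte_fin fineK//.
  by rewrite fin_num_measure.
have d6 : K * sample_mean \1_(C N) x <= K * e + K * eta.
  by rewrite -mulrDr ler_pM2l//; lra.
have d7 : K * \int[P]_x \1_(C N) x <= K * e by rewrite ler_pM2l// ltW.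
have etaE' : K * N%:R * eta + K * eta = tol / 8.
  by rewrite -etaE -(natr1 N); ring.
have -> : sample_mean f x - \int[P]_x f x =
    (sample_mean f x - sample_mean s x) + (sample_mean s x - \int[P]_x s x)
    - (\int[P]_x f x - \int[P]_x s x) by ring.
apply: (le_lt_trans (ler_normB _ _)).
apply: (@le_lt_trans _ _ (`|sample_mean f x - sample_mean s x| +
  `|sample_mean s x - \int[P]_x s x| + `|\int[P]_x f x - \int[P]_x s x|)).
  by rewrite lerD2r ler_normD.
have eE2 : 2 * K * e = tol / 4 by rewrite -mulrA eE; lra.
lra.
Qed.

(** The cells and [eta] of the finite test depend on [K] and [tol] but not on the function, so one
    union bound over [N.+1] frequency deviations serves all the [F i] simultaneously. *)
Lemma exp_decay_bounded_lipschitz_deviation (X : completeMetricMeasurableType R d)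
    (P : probability X R) (K tol : R) (F : nat -> X -> R) :
  separable X -> borel_space X -> 0 < tol ->
  (forall i, measurable_fun setT (F i)) ->
  (forall i x, `|F i x| <= K) ->
  (forall i x z, `|F i x - F i z| <= K * mdist x z) ->
  exp_decay (fun n => product_probability P n (~` [set x |
    forall i, `|sample_mean (F i) x - \int[P]_x F i x| < tol])).
Proof.
move=> sepX borelX tol0 mF FK FL.
have [N [C [eta [mC eta0 test]]]] :=
  bounded_lipschitz_finite_test X P K tol sepX borelX tol0.
pose bad n k := [set x : n.-tuple X |
  eta <= `|sample_mean \1_(C k) x - \int[P]_x \1_(C k) x|].
have mbad n k : measurable (bad n k).
  rewrite -[X in measurable X]setTI; apply: measurable_fun_le => //.
  apply: measurableT_comp => //; apply: measurable_funB => //.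
  by apply: measurable_sample_mean; exact: measurable_indic.
have mgood n : measurable [set x : n.-tuple X |
    forall i, `|sample_mean (F i) x - \int[P]_x F i x| < tol].
  exact: measurable_uniform_deviation.
have small j : exp_decay (fun n =>
    \sum_(k < j) product_probability P n (bad n k))%E.
  elim: j => [|j IHj].
    by under eq_fun do rewrite big_ord0; exact: exp_decay0.
  under eq_fun do rewrite big_ord_recr/=.
  apply: exp_decayD => //; apply: (sample_mean_deviation P _ 1) => //.
  exact: indic_norm_le1.
have [D [c [D0 c0 smallN]]] := small N.+1.
(* The added 1 covers [n = 0], where the test does not apply. *)
exists (D + 1), c; split=> //; first lra.
move=> [|n].
  rewrite expr0 mulr1; apply: (le_trans (probability_le1 _ _)).
    exact: measurableC (mgood 0%N).
  by rewrite lee_fin lerDr.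
apply: (@le_trans _ _ (D * expR (- c) ^+ n.+1)%:E); last first.
  by rewrite lee_fin ler_wpM2r ?exprn_ge0 ?expR_ge0// lerDl.
apply: le_trans (smallN n.+1).
apply: content_subadditive => //.
- by move=> k _; exact: mbad.
- exact: measurableC (mgood n.+1).
move=> x /=; apply: contra_notP => allgood i.
apply: test => // k kN; rewrite ltNge; apply/negP => badk.
by apply: allgood; rewrite -bigcup_mkord; exists k.
Qed.

End uniform_deviation.

(** * Canonical measures *)

Section canonical.
Context {d : measure_display} {T : measurableType d} {R : realType}.

(** Adding [M] makes [f] nonnegative and reduces to [ge0_integral_density]; both sides change by [M]
    since [nu] has mass 1. Here [nu] is a mere measure, as [canonical_measure] is. *)
Lemma Rintegral_density (mu : probability T R) (nu : {measure set T -> \bar R})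
    (w f : T -> R) (M W : R) : nu setT = 1%E ->
  measurable_fun setT w -> (forall x, 0 <= w x <= W) -> has_density mu nu w ->
  measurable_fun setT f -> (forall x, `|f x| <= M) ->
  \int[nu]_x f x = \int[mu]_x (f x * w x).
Proof.
move=> nu1 mw w0W nuE mf fM.
have w0 x : 0 <= w x by case/andP: (w0W x).
have wW x : `|w x| <= W by rewrite ger0_norm//; case/andP: (w0W x).
have iw := bounded_integrable mu _ _ mw wW.
have w1 : \int[mu]_x w x = 1 by rewrite /Rintegral -nuE// nu1.
have fM0 x : 0 <= f x + M by have := fM x; rewrite ler_norml; lra.
have mfw : measurable_fun setT (fun x => f x * w x) by exact: measurable_funM.
have ifw : mu.-integrable setT (EFin \o (fun x => f x * w x)).
  apply: (bounded_integrable mu _ (M * W)) => // x.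
  by rewrite normrM ler_pM.
have if_ : nu.-integrable setT (EFin \o f).
  apply: measurable_bounded_integrable => //.
    by rewrite [X in (X < _)%E]nu1 ltry.
  exists M; split; first exact: num_real.
  by move=> N MN x _; exact: le_trans (fM x) (ltW MN).
have iM : nu.-integrable setT (EFin \o (fun=> M)).
  apply: measurable_bounded_integrable => //.
    by rewrite [X in (X < _)%E]nu1 ltry.
  exists `|M|; split; first exact: num_real.
  by move=> N MN x _; exact: ltW MN.
have iMw : mu.-integrable setT (EFin \o (fun x => M * w x)).
  apply: (bounded_integrable mu _ (`|M| * W)); first exact: measurable_funM.
  by move=> x; rewrite normrM ler_wpM2l.
have : \int[nu]_x (f x + M) = \int[mu]_x (f x * w x + M * w x).
  rewrite /Rintegral (ge0_integral_density mu nu w)//.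
  - by congr fine; apply: eq_integral => x _; rewrite -EFinM mulrDl.
  - by apply/measurable_EFinP; exact: measurable_funD.
rewrite (RintegralD _ if_ iM)// (RintegralD _ ifw iMw)// RintegralZl// w1 mulr1.
have -> : \int[nu]_x M = M.
  by rewrite /Rintegral integral_cst// [X in (_ * X)%E]nu1 mule1.
by move/addIr.
Qed.

Lemma density_lower_bound (mu nu : probability T R) (w : T -> R) (A : set T)
    (a : R) : measurable_fun setT w -> (forall x, 0 <= w x) ->
  has_density mu nu w -> measurable A -> 0 <= a -> (forall x, A x -> a <= w x) ->
  (a%:E * mu A <= nu A)%E.
Proof.
move=> mw w0 nuE mA a0 aw; rewrite nuE// -integral_cst//.
apply: ge0_le_integral => //.
by apply/measurable_EFinP; exact: measurable_funTS.
Qed.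

Lemma density_upper_bound (mu nu : probability T R) (w : T -> R) (A : set T)
    (b : R) : measurable_fun setT w -> (forall x, 0 <= w x) ->
  has_density mu nu w -> measurable A -> (forall x, A x -> w x <= b) ->
  (nu A <= b%:E * mu A)%E.
Proof.
move=> mw w0 nuE mA wb; rewrite nuE// -integral_cst//.
apply: ge0_le_integral => //.
- by move=> x _; rewrite lee_fin.
- by apply/measurable_EFinP; exact: measurable_funTS.
Qed.

Variables (mu : probability T R) (g : {mfun T >-> R}) (M : R).
Hypothesis gM : forall x, `|g x| <= M.

Local Notation Z := (partition_function mu g).
Local Notation w := (fun l x => expR (l * g x) / Z l).

Lemma measurable_expg l : measurable_fun setT (fun x => expR (l * g x)).
Proof. by apply: measurableT_comp => //; exact: measurable_funM. Qed.

Lemma expg_le l x : expR (l * g x) <= expR (`|l| * M).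
Proof.
by rewrite ler_expR (le_trans (ler_norm _))// normrM ler_wpM2l.
Qed.

Lemma integrable_expg l : mu.-integrable setT (EFin \o (fun x => expR (l * g x))).
Proof.
apply: (bounded_integrable mu _ (expR (`|l| * M))); first exact: measurable_expg.
by move=> x; rewrite ger0_norm ?expR_ge0// expg_le.
Qed.

Lemma partition_function_gt0 l : 0 < Z l.
Proof.
apply: (@lt_le_trans _ _ (expR (- (`|l| * M)))); first exact: expR_gt0.
rewrite -[leLHS](Rintegral_cst_probability mu).
apply: le_Rintegral => //.
- exact: (bounded_integrable mu _ `|expR (- (`|l| * M))|).
- exact: integrable_expg.
move=> x _; rewrite ler_expR lerNl -mulNr (le_trans (ler_norm _))//.
by rewrite normrM normrN ler_wpM2l.
Qed.

(** Pointwise, [(l - l') * g x <= |l - l'| * M]. This says that the logarithm of [Z] is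
    [M]-Lipschitz, which controls the change of normalisation between nearby parameters. *)
Lemma le_partition_function l l' : Z l <= expR (`|l - l'| * M) * Z l'.
Proof.
rewrite -RintegralZl//; last exact: integrable_expg.
apply: le_Rintegral => //; first exact: integrable_expg.
  apply: (bounded_integrable mu _ (expR (`|l - l'| * M) * expR (`|l'| * M))).
    by apply: measurable_funM => //; exact: measurable_expg.
  move=> x; rewrite ger0_norm ?mulr_ge0 ?expR_ge0//.
  by rewrite ler_wpM2l ?expR_ge0// expg_le.
move=> x _; rewrite -expRD ler_expR -lerBlDr -mulrBl.
by rewrite (le_trans (ler_norm _))// normrM ler_wpM2l.
Qed.

Lemma measurable_weight l : measurable_fun setT (w l).
Proof. by apply: measurable_funM => //; exact: measurable_expg. Qed.

Lemma weight_ge0 l x : 0 <= w l x.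
Proof. by rewrite divr_ge0 ?expR_ge0// ltW// partition_function_gt0. Qed.

Lemma weight_bounds l x : 0 <= w l x <= expR (`|l| * M) / Z l.
Proof.
by rewrite weight_ge0/= ler_wpM2r ?expg_le// invr_ge0 ltW// partition_function_gt0.
Qed.

Lemma canonical_measure_setT l : canonical_measure mu g l setT = 1%E.
Proof.
have iw : mu.-integrable setT (EFin \o w l).
  apply: (bounded_integrable mu _ (expR (`|l| * M) / Z l)) => [|x].
    exact: measurable_weight.
  by rewrite ger0_norm ?weight_ge0//; case/andP: (weight_bounds l x).
rewrite /canonical_measure -[LHS]fineK; last exact: integrable_fin_num.
congr (_%:E); rewrite -[LHS]/(\int[mu]_x (expR (l * g x) / Z l)).
rewrite RintegralZr//; last exact: integrable_expg.
by rewrite divff// gt_eqF// partition_function_gt0.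
Qed.

(** Repackages [canonical_measure] as a probability, so that [product_probability] can be formed
    from it. *)
Lemma canonical_probability l : exists2 P : probability T R,
  has_density mu P (w l) &
  forall f : T -> R, \int[P]_x f x = \int[canonical_measure mu g l]_x f x.
Proof.
pose m := Measure_isProbability.Build _ _ _ (canonical_measure mu g l)
  (canonical_measure_setT l).
pose P : probability T R := HB.pack (canonical_measure mu g l) m.
by exists P.
Qed.

Lemma canonical_integral l (f : T -> R) (K : R) :
  measurable_fun setT f -> (forall x, `|f x| <= K) ->
  \int[canonical_measure mu g l]_x f x = \int[mu]_x (f x * w l x).
Proof.
move=> mf fK; apply: (Rintegral_density mu _ _ _ K (expR (`|l| * M) / Z l)) => //.
- exact: canonical_measure_setT.
- exact: measurable_weight.
- exact: weight_bounds.
Qed.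

Lemma theta0 : theta mu g 0%:E = ystar mu g.
Proof.
rewrite /theta (canonical_integral _ _ M)//; apply: eq_Rintegral => x _.
rewrite mul0r expR0 (_ : Z 0 = 1) ?divr1 ?mulr1//.
rewrite /partition_function; under eq_Rintegral do rewrite mul0r expR0.
exact: Rintegral_cst_probability.
Qed.

(* With [y = theta l], integrate
   [(g - y) * (expR ((l' - l) * g) - expR ((l' - l) * y)) >= 0] against [P_l]. *)
Lemma theta_nondecreasing l l' : l <= l' -> theta mu g l%:E <= theta mu g l'%:E.
Proof.
move=> ll'; set y := theta mu g l%:E.
have mgy : measurable_fun setT (fun x => g x - y) by exact: measurable_funB.
have gyM x : `|g x - y| <= M + `|y|.
  by rewrite (le_trans (ler_normB _ _))// lerD2r.
have centered s : \int[mu]_x ((g x - y) * w s x) = theta mu g s%:E - y.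
  rewrite -(canonical_integral _ _ (M + `|y|))// /theta.
  have [P _ PE] := canonical_probability s; rewrite -!PE.
  rewrite RintegralB ?Rintegral_cst_probability//.
  - exact: (bounded_integrable P _ M).
  - exact: (bounded_integrable P _ `|y|).
have iw s : mu.-integrable setT (EFin \o (fun x => (g x - y) * w s x)).
  apply: (bounded_integrable mu _ ((M + `|y|) * (expR (`|s| * M) / Z s))).
    by apply: measurable_funM => //; exact: measurable_weight.
  move=> x; rewrite normrM ler_pM// ger0_norm ?weight_ge0//.
  by case/andP: (weight_bounds s x).
rewrite -subr_ge0 -centered.
(* [c] turns the weight at [l] into the weight at [l'] with the exponent [(l' - l) * g] frozen at
   [(l' - l) * y]; against the weight at [l], [g - y] integrates to 0. *)
pose c := expR ((l' - l) * y) * (Z l / Z l').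
have -> : 0 = c * \int[mu]_x ((g x - y) * w l x) by rewrite centered subrr mulr0.
rewrite -RintegralZl//; apply: le_Rintegral => //.
  apply: (bounded_integrable mu _ (c * ((M + `|y|) * (expR (`|l| * M) / Z l)))).
    apply: measurable_funM => //; apply: measurable_funM => //.
    exact: measurable_weight.
  have c0 : 0 <= c.
    by rewrite mulr_ge0 ?expR_ge0// divr_ge0// ltW// partition_function_gt0.
  move=> x; rewrite normrM (ger0_norm c0) ler_wpM2l// normrM ler_pM//.
  by rewrite ger0_norm ?weight_ge0//; case/andP: (weight_bounds l x).
move=> x _.
have Zl := partition_function_gt0 l; have Zl' := partition_function_gt0 l'.
have -> : c * ((g x - y) * (expR (l * g x) / Z l)) =
    (g x - y) * (expR ((l' - l) * y) * expR (l * g x)) / Z l'.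
  by rewrite /c; field; rewrite !gt_eqF.
rewrite [leRHS]mulrA ler_wpM2r ?invr_ge0 ?(ltW Zl')//.
have -> : l' * g x = (l' - l) * g x + l * g x by ring.
rewrite expRD.
have [gy|gy] := lerP y (g x).
  rewrite ler_wpM2l ?subr_ge0// ler_wpM2r ?expR_ge0// ler_expR ler_wpM2l//.
  by rewrite subr_ge0.
rewrite ler_wnM2l ?subr_le0 ?(ltW gy)// ler_wpM2r ?expR_ge0// ler_expR.
by rewrite ler_wpM2l ?subr_ge0// ltW.
Qed.

End canonical.

(** * The inverse of theta and the conditioning interval *)

(** [v] and [r] are the centre and half-length of the interval from [m] to [y], where [m] is the
    largest of [t], [y - delta] and [y - eps]. In use, [lo] is [ymin g] and [t] is the value of
    theta at [l - eps]; [window_above] is the mirror image. *)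
Lemma window_below {R : realType} (lo t y delta eps : R) :
  lo <= t -> t < y -> 0 < delta -> 0 < eps ->
  exists v r, [/\ 0 < r, lo < v, t < v, v < y &
    forall u, `|u - v| < r -> y - delta < u <= y /\ `|u - y| <= eps].
Proof.
move=> lot ty delta0 eps0.
have [m [mt md me my]] : exists m,
    [/\ t <= m, y - delta <= m, y - eps <= m & m < y].
  exists (Num.max t (Num.max (y - delta) (y - eps))).
  by rewrite !le_max !gt_max !lexx !orbT ty !gtrBl delta0.
exists ((m + y) / 2), ((y - m) / 2); split; [lra..|].
by move=> u; rewrite ltr_norml ler_norml; lra.
Qed.

Lemma window_above {R : realType} (hi t y delta eps : R) :
  t <= hi -> y < t -> 0 < delta -> 0 < eps ->
  exists v r, [/\ 0 < r, v < hi, v < t, y < v &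
    forall u, `|u - v| < r -> y <= u < y + delta /\ `|u - y| <= eps].
Proof.
move=> thi yt delta0 eps0.
have [m [mt md me my]] : exists m,
    [/\ m <= t, m <= y + delta, m <= y + eps & y < m].
  exists (Num.min t (Num.min (y + delta) (y + eps))).
  by rewrite !ge_min !lt_min !lexx !orbT yt !ltrDl delta0.
exists ((m + y) / 2), ((m - y) / 2); split; [lra..|].
by move=> u; rewrite ltr_norml ler_norml; lra.
Qed.

Section theta_invertible.
Context {d : measure_display} {T : measurableType d} {R : realType}.
Variables (mu : probability T R) (g : {mfun T >-> R}) (M : R).
Hypothesis gM : forall x, `|g x| <= M.
Hypothesis htheta : theta_invertible mu g.

(** Injectivity makes the monotonicity strict. *)
Lemma theta_increasing l l' : l < l' -> theta mu g l%:E < theta mu g l'%:E.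
Proof.
move=> ll'; rewrite lt_neqAle (theta_nondecreasing mu g M gM) ?ltW// andbT.
apply/eqP => e; have [_ inj _] := htheta.
have [ll] := inj l%:E l'%:E (mem_set I) (mem_set I) e.
by move: ll'; rewrite ll ltxx.
Qed.

Lemma theta_onto_real y : ymin g < y < ymax g -> exists l, theta mu g l%:E = y.
Proof.
move=> /andP[yl yr]; have [_ _ surj] := htheta.
have [|[l| |] _ ly] := surj y; first by rewrite /= in_itv/= !ltW.
- by exists l.
- by move: ly yr => /= ->; rewrite ltxx.
- by move: ly yl => /= ->; rewrite ltxx.
Qed.

(** The infinite parameters are sent to [ymin g] and [ymax g], which [y] avoids, so [fine] acts on a
    real number. *)
Lemma theta_invK y : ymin g < y < ymax g ->
  theta mu g (fine (theta_inv mu g y))%:E = y.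
Proof.
move=> yI; have [l ly] := theta_onto_real y yI.
have [_ inj _] := htheta.
have -> : theta_inv mu g y = l%:E by rewrite /theta_inv -ly pinvKV ?inE.
by [].
Qed.

Variables (y delta : R).
Hypotheses (hy : ymin g < y < ymax g) (delta0 : 0 < delta).

Local Notation l := (fine (theta_inv mu g y)).

(** The reason for the one-sided intervals: theta is monotone with value [ystar mu g] at 0, so [l]
    has the sign of [y - ystar mu g], and the interval lies on the matching side of [y]. At
    [y = ystar mu g] strict monotonicity forces [l = 0]. *)
Lemma cond_interval_sign u : cond_interval mu g y delta u -> 0 <= l * (u - y).
Proof.
have ly := theta_invK y hy; have t0 := theta0 mu g M gM.
have mono a b := theta_nondecreasing mu g M gM a b.
rewrite /cond_interval; case: ifPn => [yy|yy].
  rewrite /= in_itv/= => /andP[_ uy].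
  have l0 : l <= 0.
    rewrite leNgt; apply/negP => /ltW/mono; rewrite ly t0 leNgt yy//.
  by rewrite mulr_le0// subr_le0.
case: ifPn => [yy'|yy'].
  rewrite /= in_itv/= => /andP[yu _].
  have l0 : 0 <= l.
    rewrite leNgt; apply/negP => /ltW/mono; rewrite ly t0 leNgt yy'//.
  by rewrite mulr_ge0// subr_ge0.
move=> _; suff -> : l = 0 by rewrite mul0r.
have yE : y = ystar mu g by apply/eqP; rewrite eq_le !leNgt yy yy'.
case: (ltgtP l 0) => // /(theta_increasing _ _).
- by rewrite ly t0 yE ltxx.
- by rewrite ly t0 yE ltxx.
Qed.

(** When [y] differs from [ystar mu g] it is an endpoint of the interval, so concentration around
    [y] would not force the sample mean inside. A value [v] strictly inside, between [y] and theta
    at [l - eps] or [l + eps], is attained at some [l'], and monotonicity places [l'] within [eps]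
    of [l]. *)
Lemma cond_interval_tilt eps : 0 < eps -> exists l' r : R,
  [/\ 0 < r, `|l' - l| <= eps &
    forall u, `|u - theta mu g l'%:E| < r ->
      cond_interval mu g y delta u /\ `|u - y| <= eps].
Proof.
move=> eps0; have ly := theta_invK y hy; have t0 := theta0 mu g M gM.
have [ylo yhi] := andP hy.
have bounds s : ymin g <= theta mu g s%:E <= ymax g.
  have [fun_ _ _] := htheta; have := fun_ s%:E I.
  by rewrite /= in_itv.
have mono a b : theta mu g a%:E < theta mu g b%:E -> a < b.
  by apply: contraTT; rewrite -!leNgt; exact: (theta_nondecreasing mu g M gM).
rewrite /cond_interval; case: ifPn => [yy|yy].
  have lt1 : theta mu g (l - eps)%:E < y.
    by rewrite -[ltRHS]ly theta_increasing// gtrBl.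
  have [ge1 _] := andP (bounds (l - eps)).
  have [v [r [r0 lov tv vy H]]] := window_below _ _ _ _ _ ge1 lt1 delta0 eps0.
  have [|l' l'E] := theta_onto_real v; first by rewrite lov (lt_trans vy).
  exists l', r; rewrite l'E; split; first by [].
    have /ltW h1 : l - eps < l' by apply: mono; rewrite l'E.
    have /ltW h2 : l' < l by apply: mono; rewrite l'E ly.
    by rewrite ler_distl h1 (le_trans h2)// lerDl ltW.
  by move=> u /H[uy ueps]; rewrite /= in_itv.
case: ifPn => [yy'|yy'].
  have lt1 : y < theta mu g (l + eps)%:E.
    by rewrite -[ltLHS]ly theta_increasing// ltrDl.
  have [_ le1] := andP (bounds (l + eps)).
  have [v [r [r0 hiv tv vy H]]] := window_above _ _ _ _ _ le1 lt1 delta0 eps0.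
  have [|l' l'E] := theta_onto_real v; first by rewrite hiv (lt_trans ylo).
  exists l', r; rewrite l'E; split; first by [].
    have /ltW h1 : l' < l + eps by apply: mono; rewrite l'E.
    have /ltW h2 : l < l' by apply: mono; rewrite l'E ly.
    by rewrite ler_distl h1 andbT (le_trans _ h2)// gerBl ltW.
  by move=> u /H[uy ueps]; rewrite /= in_itv.
have yE : y = ystar mu g by apply/eqP; rewrite eq_le !leNgt yy yy'.
(* Here [y] is the centre of the interval and [l] itself serves. *)
exists l, (Num.min delta eps); rewrite ly lt_min delta0 eps0; split=> //.
  by rewrite subrr normr0 ltW.
move=> u; rewrite lt_min => /andP[ud /ltW ue]; split=> //.
by rewrite /= in_itv/= -yE -ltr_distlC distrC.
Qed.

End theta_invertible.

(** * Conditional probabilities *)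

Lemma exp_decay_eventually {R : realType} (u : nat -> \bar R) (e : R) :
  exp_decay u -> 0 < e -> \forall n \near \oo, (u n <= e%:E)%E.
Proof.
move=> [C [c [C0 c0 uC]]] e0.
have : (C * expR (- c) ^+ n) @[n --> \oo] --> (0 : R).
  rewrite -[X in _ --> X](mulr0 C); apply: cvgMr; apply: cvg_expr.
  by rewrite ger0_norm ?expR_ge0// -expR0 ltr_expR oppr_lt0.
move=> /cvgrPdist_lt/(_ _ e0); apply: filterS => n.
rewrite sub0r normrN => /(le_lt_trans (ler_norm _))/ltW Ce.
by apply: (le_trans (uC n)); rewrite lee_fin.
Qed.

Lemma bl_norm_bounds {R : realType} (X : metricType R) (f : X -> R) (K : R) :
  (bl_norm f <= K%:E)%E ->
  (forall x, `|f x| <= K) /\ (forall x z, `|f x - f z| <= K * mdist x z).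
Proof.
move=> blK.
have lip0 : (0 <= lip_norm f)%E by rewrite /lip_norm le_max lexx.
have sup_ge x : (`|f x|%:E <= sup_norm f)%E by apply: ereal_sup_ubound; exists x.
have fK x : `|f x| <= K.
  by rewrite -lee_fin (le_trans (sup_ge x))// (le_trans _ blK)// leeDr.
split=> // x z; have [->|xz] := eqVneq x z.
  by rewrite subrr normr0 mdistxx mulr0.
rewrite -ler_pdivrMr ?mdist_gt0// -lee_fin (le_trans _ blK)//.
apply: (@le_trans _ _ (lip_norm f)).
  rewrite /lip_norm le_max; apply/orP; right.
  by apply: ereal_sup_ubound; exists (x, z).
by rewrite leeDl// (le_trans _ (sup_ge x)).
Qed.

Lemma cond_prob_setD {d : measure_display} {T : measurableType d} {R : realType}
    (P : probability T R) (A B : set T) : measurable A -> measurable B ->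
  fine (P B) != 0 -> 1 - cond_prob P A B = fine (P (B `\` A)) / fine (P B).
Proof.
move=> mA mB PB0; rewrite /cond_prob.
have -> : fine (P (B `\` A)) = fine (P B) - fine (P (A `&` B)).
  rewrite measureD// ?(ltey_eq, fin_num_measure)//.
  rewrite setIC fineB ?fin_num_measure//; exact: measurableI.
by rewrite mulrBl divff.
Qed.

(** [a] stands for the mass of the bad part of the conditioning event and [m] for the mass of the
    whole event; the common factor [D ^+ n] cancels in the quotient. The lower bound also yields
    [0 < m], so the conditional probability is a genuine quotient. *)
Lemma ratio_bound {R : realType} (a m D k q C : R) n :
  0 < D -> 0 < k -> 0 <= a -> D ^+ n * a <= C * q ^+ n ->
  2^-1 <= (D * k) ^+ n * m -> 0 < m /\ a / m <= 2 * C * (q * k) ^+ n.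
Proof.
move=> D0 k0 a0 aC m2.
have Dn : 0 < D ^+ n by rewrite exprn_gt0.
have kn : 0 < k ^+ n by rewrite exprn_gt0.
have m0 : 0 < m.
  rewrite -(pmulr_rgt0 _ (exprn_gt0 n (mulr_gt0 D0 k0))); lra.
split=> //; rewrite ler_pdivrMr// -(ler_pM2l Dn); apply: (le_trans aC).
have -> : D ^+ n * (2 * C * (q * k) ^+ n * m) =
    C * q ^+ n * (2 * ((D * k) ^+ n * m)).
  by rewrite !exprMn; ring.
rewrite ler_peMr//; last lra.
by apply: le_trans aC; rewrite mulr_ge0// ltW.
Qed.

(** The density of the product measure depends on the sample only through its mean, so bounds on the
    mean become bounds on the density. *)
Lemma prod_canonical_weight {d : measure_display} {T : measurableType d}
    {R : realType} n (x : n.-tuple T)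
    (g : T -> R) (l Z : R) :
  \prod_(i < n) (expR (l * g (tnth x i)) / Z) =
  (expR (l * sample_mean g x) / Z) ^+ n.
Proof.
rewrite prodf_div prodr_const card_ord expr_div_n; congr (_ / _).
rewrite -expR_sum -expRM_natl; congr expR.
rewrite -mulr_sumr /sample_mean; case: n x => [|n] x.
  by rewrite big_ord0 !mulr0.
by field; rewrite addrC natr1 pnatr_eq0.
Qed.

(** Split the difference as [(l' - l) * u + l * (u - y)], with [|u|] at most [|y| + 1]. *)
Lemma exponent_bound {R : realType} (l l' u y eps : R) :
  `|l' - l| <= eps -> `|u - y| <= eps -> eps <= 1 ->
  l' * u - l * y <= eps * (`|y| + 1 + `|l|).
Proof.
move=> ll uy eps1.
have u1 : `|u| <= `|y| + 1.
  rewrite -[u](subrK y) addrC (le_trans (ler_normD _ _))// lerD2l.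
  exact: le_trans uy eps1.
have -> : l' * u - l * y = (l' - l) * u + l * (u - y) by ring.
rewrite [leRHS]mulrDr lerD// (le_trans (ler_norm _))// normrM.
  exact: ler_pM.
by rewrite mulrC ler_wpM2r.
Qed.

Theorem theorem2 (R : realType) (d : measure_display)
    (X : completeMetricMeasurableType R d)
    (hsep : separable X) (hborel : borel_space X)
    (mu : probability X R)
    (g : {mfun X >-> R})
    (hgbnd : exists M : R, forall x : X, `|g x| <= M)
    (hgcont : {ae mu, forall x : X, {for x, continuous (g : X -> R)}})
    (T : set R) (hT0 : T 0)
    (phi : R -> X -> X)
    (hphimeas : forall t : R, T t -> measurable_fun [set: X] (phi t))
    (hphicont : forall t : R, T t ->
       {ae mu, forall x : X, {for x, continuous (phi t)}})
    (hphi0 : forall x : X, phi 0 x = x)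
    (htheta : theta_invertible mu g)
    (y : R) (hymin : ymin g < y) (hymax : y < ymax g)
    (delta : R) (hdelta : 0 < delta)
    (delta' : R) (hdelta' : 0 < delta')
    (t : nat -> R) (ht : forall i : nat, T (t i))
    (hBL : uniformly_bounded_lipschitz (fun i : nat => g \o phi (t i))) :
  (fun n : nat =>
     cond_prob (product_probability mu n)
       [set x : n.-tuple X | forall i : nat,
          `|sample_mean (g \o phi (t i)) x - psi mu g phi (t i) y| < delta']
       [set x : n.-tuple X | cond_interval mu g y delta (sample_mean g x)])
    @ \oo --> (1 : R).
Proof.
have [M gM] := hgbnd.
have hy : ymin g < y < ymax g by rewrite hymin.
have [K FK] := hBL.
pose l := fine (theta_inv mu g y).
pose Z := partition_function mu g.
have Z0 s : 0 < Z s by exact: partition_function_gt0 gM s.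
have M0 : 0 <= M.
  by have [x _] := probability_nonempty mu; exact: le_trans (gM x).
pose F i := g \o phi (t i).
have mF i : measurable_fun setT (F i).
  by apply: measurableT_comp => //; exact: hphimeas.
pose A n := [set x : n.-tuple X | forall i,
  `|sample_mean (F i) x - psi mu g phi (t i) y| < delta'].
pose B n := [set x : n.-tuple X | cond_interval mu g y delta (sample_mean g x)].
have mA n : measurable (A n) by exact: measurable_uniform_deviation.
have mB n : measurable (B n).
  apply: measurable_sample_mean_preimage => //.
  rewrite /cond_interval; case: ifPn => _; first exact: measurable_itv.
  by case: ifPn => _; exact: measurable_itv.
have [P Pdens PE] := canonical_probability mu g M gM l.
have [C [c [C0 c0 devP]]] : exp_decay (fun n => product_probability P n (~` A n)).
  have := exp_decay_bounded_lipschitz_deviation X P K delta' F hsep hborel hdelta'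
    mF (fun i => (bl_norm_bounds X _ _ (FK i)).1)
    (fun i => (bl_norm_bounds X _ _ (FK i)).2).
  by apply: le_exp_decay => n; under eq_set do under eq_forall do rewrite PE.
(* The loss allowed per sample in the lower bound. It uses half of the decay rate [c], so that
   [expR (- c) * k] is still below 1. *)
pose k := expR (c / 2).
pose D := expR (l * y) / Z l.
have D0 : 0 < D by rewrite divr_gt0 ?expR_gt0.
have k0 : 0 < k by exact: expR_gt0.
have mw s : measurable_fun setT (fun x => expR (s * g x) / Z s).
  exact: measurable_weight.
have w0 s x : 0 <= expR (s * g x) / Z s by exact: weight_ge0 gM s x.
have mpw s n : measurable_fun setT
    (fun x : n.-tuple X => \prod_(i < n) (expR (s * g (tnth x i)) / Z s)).
  exact: (measurable_prod_tnth n _ (mw s)).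
have pw0 s n (x : n.-tuple X) :
    0 <= \prod_(i < n) (expR (s * g (tnth x i)) / Z s).
  exact: prodr_ge0.
have upper n : D ^+ n * fine (product_probability mu n (B n `\` A n)) <=
    C * expR (- c) ^+ n.
  have mBA : measurable (B n `\` A n) by exact: (measurableD (mB n) (mA n)).
  rewrite -lee_fin EFinM fineK ?fin_num_measure//.
  apply: le_trans (devP n).
  apply: (@le_trans _ _ (product_probability P n (B n `\` A n))); last first.
    by apply: le_measure; rewrite ?inE//; exact: (measurableC (mA n)).
  apply: (density_lower_bound _ _ _ _ _ (mpw l n) (pw0 l n)
    (product_density mu P _ n (mw l) (w0 l) Pdens) mBA).
    by rewrite exprn_ge0// ltW.
  move=> x [Bx _]; rewrite prod_canonical_weight.
  rewrite lerXn2r ?nnegrE ?(ltW D0)//; first by rewrite divr_ge0 ?expR_ge0 ?ltW.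
  rewrite ler_pM2r ?invr_gt0// ler_expR -subr_ge0 -mulrBr.
  exact: cond_interval_sign gM htheta _ _ hy _ Bx.
(* The first three terms come from [exponent_bound], the last from [le_partition_function]. With
   [eps * E <= c / 4] the exponent and the normalisation lose at most [c / 4] each, together the
   logarithm of [k]. *)
pose E := `|y| + 1 + `|l| + M.
have E0 : 0 < E by rewrite /E; have := normr_ge0 y; have := normr_ge0 l; lra.
pose eps := Num.min 1 (c / 4 / E).
have eps0 : 0 < eps by rewrite lt_min ltr01 !divr_gt0.
have eps1 : eps <= 1 by rewrite ge_min lexx.
have epsE : eps * E <= c / 4.
  by rewrite -ler_pdivlMr// ge_min lexx orbT.
have [l' [r [r0 l'l near_y]]] :=
  cond_interval_tilt mu g M gM htheta y delta hy hdelta eps eps0.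
have [P' P'dens P'E] := canonical_probability mu g M gM l'.
have lower : \forall n \near \oo,
    2^-1 <= (D * k) ^+ n * fine (product_probability mu n (B n)).
  have half0 : 0 < 2^-1 :> R by rewrite invr_gt0.
  have := exp_decay_eventually _ _
    (sample_mean_deviation P' g M r (measurable_funPT g) gM r0) half0.
  apply: filterS => n devP'.
  (* Under the tilted measure the sample mean concentrates at theta of [l'], so [G] eventually has
     mass at least 1/2; it lies in [B n], and on it the density is at most [(D * k) ^+ n]. *)
  pose G := [set x : n.-tuple X | `|sample_mean g x - theta mu g l'%:E| < r].
  pose bad := [set x : n.-tuple X | r <= `|sample_mean g x - \int[P']_x g x|].
  have mbad : measurable bad.
    rewrite -[X in measurable X]setTI; apply: measurable_fun_le => //.
    apply: measurableT_comp => //; apply: measurable_funB => //.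
    exact: measurable_sample_mean.
  have GE : G = ~` bad.
    by apply/seteqP; split=> x; rewrite /G /bad /= P'E ltNge => /negP.
  have mG : measurable G by rewrite GE; exact: (measurableC mbad).
  have GB : G `<=` B n by move=> x /near_y[].
  have PG : (2^-1%:E <= product_probability P' n G)%E.
    rewrite GE probability_setC//.
    have : (product_probability P' n bad <= (2^-1)%:E)%E by exact: devP'.
    rewrite -[product_probability P' n bad]fineK ?fin_num_measure//.
    by rewrite -EFinB !lee_fin; lra.
  rewrite -lee_fin EFinM fineK; last exact: (fin_num_measure _ _ (mB n)).
  apply: (le_trans PG).
  apply: (@le_trans _ _
    (((D * k) ^+ n)%:E * product_probability mu n G)%E); last first.
    apply: lee_wpmul2l.
      by rewrite lee_fin exprn_ge0// ltW// mulr_gt0.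
    by apply: le_measure GB; rewrite inE; [exact: mG|exact: mB].
  apply: (density_upper_bound _ _ _ _ _ (mpw l' n) (pw0 l' n)
    (product_density mu P' _ n (mw l') (w0 l') P'dens) mG).
  move=> x /near_y[_ xy]; rewrite prod_canonical_weight.
  rewrite lerXn2r ?nnegrE ?mulr_ge0 ?invr_ge0 ?expR_ge0 ?(ltW D0) ?(ltW k0)
    ?(ltW (Z0 _))//.
  have ZZ : Z l <= expR (c / 4) * Z l'.
    apply: (le_trans (le_partition_function mu g M gM l l')).
    rewrite ler_wpM2r ?(ltW (Z0 _))// ler_expR distrC.
    apply: (@le_trans _ _ (eps * M)); first by rewrite ler_wpM2r.
    apply: le_trans epsE; rewrite ler_wpM2l ?(ltW eps0)// /E lerDr.
    by rewrite !addr_ge0.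
  have expo : l' * sample_mean g x <= l * y + c / 4.
    rewrite -lerBlDl; apply: (le_trans (exponent_bound _ _ _ _ _ l'l xy eps1)).
    by apply: le_trans epsE; rewrite ler_wpM2l ?(ltW eps0)// /E lerDl.
  rewrite ler_pdivrMr// /D /k.
  apply: (@le_trans _ _ (expR (l * y + c / 4))); first by rewrite ler_expR.
  have -> : expR (l * y) / Z l * expR (c / 2) * Z l' =
      expR (l * y + c / 4) * (expR (c / 4) * Z l') / Z l.
    have -> : c / 2 = c / 4 + c / 4 by lra.
    by rewrite !expRD; field; rewrite gt_eqF.
  by rewrite ler_pdivlMr// ler_wpM2l ?expR_ge0.
apply/cvgrPdist_lt => e e0.
have lim0 : (2 * C * (expR (- c) * k) ^+ n) @[n --> \oo] --> (0 : R).
  rewrite -[X in _ --> X](mulr0 (2 * C)); apply: cvgMr; apply: cvg_expr.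
  rewrite -expRD ger0_norm ?expR_ge0// -[ltRHS]expR0 ltr_expR; lra.
move/cvgrPdist_lt : lim0 => /(_ _ e0) lim0.
near=> n.
(* The complementary conditional probability is the mass of [B n] outside [A n] divided by that of
   [B n], to which [ratio_bound] applies. *)
have a0 : 0 <= fine (product_probability mu n (B n `\` A n)).
  by rewrite fine_ge0.
have lown : 2^-1 <= (D * k) ^+ n * fine (product_probability mu n (B n)).
  by near: n; exact: lower.
have [m0 am] := ratio_bound _ _ _ _ _ _ _ D0 k0 a0 (upper n) lown.
rewrite (cond_prob_setD _ _ _ (mA n) (mB n)); last by rewrite gt_eqF.
rewrite ger0_norm ?divr_ge0 ?(ltW m0)//; apply: (le_lt_trans am).
have : `|0 - 2 * C * (expR (- c) * k) ^+ n| < e by near: n; exact: lim0.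
by rewrite sub0r normrN => /(le_lt_trans (ler_norm _)).
Unshelve. all: end_near.
Qed.
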